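(* (i) Statement (D) implies statement (S), where (D) and (S) are the following two statements. (D): For every finite abelian group $G$, every positive integer $k$, every two $k$-subsets $A=\{a_1,\ldots,a_k\}$ and $B=\{b_1,\ldots,b_k\}$ of $G$, and every field $K$ containing an element of multiplicative order $|G|$, there are $\chi_1,\ldots,\chi_k\in\hat G$ such that $\det(\chi_i(a_j))_{1\le i,j\le k}$ and $\det(\chi_i(b_j))_{1\le i,j\le k}$ are both nonzero, where $\hat G$ is the group of all group homomorphisms from $G$ to $K^*=K\setminus\{0\}$. (S): For every abelian group $G$ of (finite) odd order, every positive integer $k$, and every two $k$-subsets $A=\{a_1,\ldots,a_k\}$ and $B=\{b_1,\ldots,b_k\}$ of $G$, there is a permutation $\pi\in S_k$ such that $a_1b_{\pi(1)},\ldots,a_kb_{\pi(k)}$ are pairwise distinct. (ii) Let $G$ be a finite abelian group, let $A=\{a_1,\ldots,a_k\}$ and $B=\{b_1,\ldots,b_k\}$ be two $k$-subsets of $G$, let $K$ be any field containing an element of multiplicative order $|G|$, and let $\hat G$ be the group of all group homomorphisms from $G$ to $K^*$. Assume that there is a $\pi\in S_k$ such that $C=\{a_1b_{\pi(1)},\ldots,a_kb_{\pi(k)}\}$ is a set with exactly $k$ elements and $\{a_1b_{\tau(1)},\ldots,a_kb_{\tau(k)}\}\neq C$ for all $\tau\in S_k\setminus\{\pi\}$. Then: (a) there are $\chi_1,\ldots,\chi_k\in\hat G$ such that $\det(\chi_i(a_j))_{1\le i,j\le k}$ and $\det(\chi_i(b_j))_{1\le i,j\le k}$ are both nonzero; (b)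 there are $\chi_1,\ldots,\chi_k\in\hat G$ such that $\det(\chi_i(a_j))_{1\le i,j\le k}$ and $\mathrm{per}(\chi_i(b_j))_{1\le i,j\le k}$ are both nonzero; (c) there are $\psi_1,\ldots,\psi_k\in\hat G$ such that $\mathrm{per}(\psi_i(a_j))_{1\le i,j\le k}$ and $\mathrm{per}(\psi_i(b_j))_{1\le i,j\le k}$ are both nonzero.
   Context: Groups are written multiplicatively. $S_k$ is the symmetric group on $\{1,\ldots,k\}$. A $k$-subset is a subset with exactly $k$ elements; when it is written $\{a_1,\ldots,a_k\}$ the $a_i$ are pairwise distinct. For a $k\times k$ matrix $M=(m_{ij})$ over a commutative ring with identity, $\mathrm{per}(M)=\sum_{\sigma\in S_k}m_{1\sigma(1)}\cdots m_{k\sigma(k)}$ denotes the permanent of $M$. *)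

(* Defs.v *)
From HB Require Import structures.
From mathcomp Require Import all_boot all_order all_algebra all_fingroup.

Set Implicit Arguments.
Unset Strict Implicit.
Unset Printing Implicit Defensive.

Import GRing.Theory.

(* A finite abelian group is a finGroupType gT with abelian [set: gT].
   A k-subset {a_1, ..., a_k} of gT is given by an injective enumeration
   a : 'I_k -> gT. *)

Local Open Scope ring_scope.

Definition permanent (R : comPzRingType) (k : nat) (M : 'M[R]_k) : R :=
  \sum_(s : 'S_k) \prod_(i < k) M i (s i).

(* The elements of the dual group: group homomorphisms from gT to K \ {0}. *)
Record dual_char (gT : finGroupType) (K : fieldType) := DualChar {
  dual_char_fun :> gT -> K;
  dual_char_neq0 : forall x, dual_char_fun x != 0;
  dual_charM : forall x y,
    dual_char_fun (x * y)%g = dual_char_fun x * dual_char_fun y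
}.

Definition char_mx (gT : finGroupType) (K : fieldType) (k : nat)
    (chi : 'I_k -> dual_char gT K) (a : 'I_k -> gT) : 'M[K]_k :=
  \matrix_(i < k, j < k) chi i (a j).

Definition prod_set (gT : finGroupType) (k : nat) (a b : 'I_k -> gT)
    (s : 'S_k) : {set gT} :=
  [set (a i * b (s i))%g | i : 'I_k].

Definition statement_D : Prop :=
  forall (gT : finGroupType), abelian [set: gT] ->
  forall (k : nat), (0 < k)%N ->
  forall (a b : 'I_k -> gT), injective a -> injective b ->
  forall (K : fieldType), (exists z : K, #|gT|.-primitive_root z) ->
  exists chi : 'I_k -> dual_char gT K,
    \det (char_mx chi a) != 0 /\ \det (char_mx chi b) != 0.

Definition statement_S : Prop :=
  forall (gT : finGroupType), abelian [set: gT] -> odd #|gT| ->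
  forall (k : nat), (0 < k)%N ->
  forall (a b : 'I_k -> gT), injective a -> injective b ->
  exists pi : 'S_k, injective (fun i => a i * b (pi i))%g.

(* Main.v *)
Require Import Defs.
From HB Require Import structures.
From mathcomp Require Import all_boot all_order all_algebra all_fingroup.
From mathcomp Require Import all_solvable all_field all_character.

Set Implicit Arguments.
Unset Strict Implicit.
Unset Printing Implicit Defensive.

Import GRing.Theory.
Local Open Scope ring_scope.

(** Both parts read off the expansion of a product of two signed or unsigned
    permanents of the character matrices of [a] and [b].

    Since [K] has a primitive [#|G|]-th root of unity, the characters of [G]
    with values in [K] separate the points of [G] ([dual_char_separates]).
    Products of characters are characters, so Lagrange interpolation turns
    this into: the indicator function of the identity is a [K]-linear
    combination of characters ([indicator1_char_comb]).

    Part (ii).  For weights [w1], [w2] on permutations, the product of the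
    two weighted permanents attached to a tuple [chi] is
    [\sum_s \sum_t w1 s * w2 t * \prod_i chi i (a (s i) * b (t i))].  Taking
    a suitable linear combination of these over all tuples of characters
    replaces every [chi i] by the indicator function of
    [c i := a i * b (pi i)].  What is left is the sum of [w1 s * w2 t] over
    the pairs [(s, t)] with [a (s i) * b (t i) = c i] for all [i].  Such a
    pair gives [prod_set a b (s^-1 * t) = prod_set a b pi], so the uniqueness
    of [pi] leaves only [(1, pi)], and the combination equals
    [w1 1 * w2 pi], which is 1 or -1 for determinants and permanents.  Hence
    some tuple of characters makes both factors nonzero
    ([immanant_char_mx_neq0]).

    Part (i).  If [#|G|] is odd, a finite field of characteristic 2 has a
    primitive [#|G|]-th root of unity ([pchar2_prim_root_exists]), and over
    it the determinant of the character matrix of [b] is its permanent.  The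
    product of a determinant and a permanent is a sum of determinants
    ([det_mul_permanent]): here
    [\sum_s \det (char_mx chi (fun j => a j * b (s j)))].  A nonzero summand
    cannot have two equal columns, so its [s] is the required permutation. *)

(** * Characters separate points *)

Section DualChar.

Variables (gT : finGroupType) (K : fieldType).
Implicit Types (chi psi : dual_char gT K) (f g : gT -> K) (x y : gT).

Definition dual_char1 : dual_char gT K :=
  @DualChar gT K (fun=> 1) (fun=> oner_neq0 K) (fun _ _ => esym (mulr1 1)).

Lemma dual_char_mul_neq0 chi psi x : chi x * psi x != 0.
Proof. by rewrite mulf_neq0 ?dual_char_neq0. Qed.

Lemma dual_char_mulM chi psi x y :
  chi (x * y)%g * psi (x * y)%g = (chi x * psi x) * (chi y * psi y).
Proof. by rewrite !dual_charM mulrACA. Qed.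

Definition dual_char_mul chi psi : dual_char gT K :=
  DualChar (dual_char_mul_neq0 chi psi) (dual_char_mulM chi psi).

Lemma dual_char_at1 chi : chi 1%g = 1.
Proof.
apply: (mulfI (dual_char_neq0 chi 1%g)).
by rewrite -dual_charM mulg1 mulr1.
Qed.

(** An ordinary linear character of [G] takes values in the powers of a
    primitive [#|G|]-th root of unity; sending that root to one in [K]
    transports the character to [K].  So separation over [K] follows from the
    fact that the kernels of the irreducible complex characters, which are
    linear as [G] is abelian, meet trivially. *)
Lemma dual_char_separates (z : K) :
    abelian [set: gT] -> #|gT|.-primitive_root z ->
  forall x, x != 1%g -> exists chi, chi x != 1.
Proof.
move=> abG prz x xn1.
have [i xi] : exists i : Iirr [set: gT]%G, 'chi_i x != 1.
  apply/existsP; apply: contraR xn1 => /existsPn chi1.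
  suff: x \in \bigcap_(i : Iirr [set: gT]%G) cfker 'chi_i.
    by rewrite TI_cfker_irr => /set1P->.
  apply/bigcapP=> i _; rewrite cfkerEirr inE.
  have /lin_char1-> := char_abelianP _ abG i.
  by have := chi1 i; rewrite negbK.
have lin := char_abelianP _ abG i.
have [w prw] := C_prim_root_exists (prim_order_gt0 prz).
have chiX y : 'chi_i y ^+ #|gT| = 1.
  rewrite -(lin_charX lin) ?inE // -cardsT expg_cardG ?inE //.
  exact: lin_char1.
(* The discrete logarithm of the character, a morphism modulo [#|gT|]. *)
pose e y := prim_rootP prw (chiX y) : {j : 'I_#|gT| | 'chi_i y = w ^+ j}.
have eM y1 y2 : z ^+ sval (e (y1 * y2)%g) = z ^+ sval (e y1) * z ^+ sval (e y2).
  apply/eqP; rewrite -exprD (eq_prim_root_expr prz) -(eq_prim_root_expr prw).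
  rewrite exprD -(svalP (e _)) -(svalP (e y1)) -(svalP (e y2)).
  by rewrite (lin_charM lin) ?inE.
have e_neq0 y : z ^+ sval (e y) != 0.
  by rewrite expf_neq0 // (prim_root_eq0 prz) -lt0n (prim_order_gt0 prz).
exists (DualChar e_neq0 eM) => /=; apply: contra xi.
rewrite -(expr0 z) (eq_prim_root_expr prz) -(eq_prim_root_expr prw) expr0.
by rewrite -(svalP (e x)).
Qed.

(** * The indicator of the identity as a combination of characters *)

Definition char_comb f :=
  exists r : seq (K * dual_char gT K), forall x, f x = \sum_(p <- r) p.1 * p.2 x.

Lemma char_combM f g :
  char_comb f -> char_comb g -> char_comb (fun x => f x * g x).
Proof.
move=> [r Hr] [t Ht].
exists [seq (p.1.1 * p.2.1, dual_char_mul p.1.2 p.2.2) |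
         p <- [seq (p, q) | p <- r, q <- t]] => x.
rewrite Hr Ht big_distrlr big_map big_allpairs /=.
by apply: eq_bigr => p _; apply: eq_bigr => q _; rewrite mulrACA.
Qed.

(** The family of characters and coefficients has to be indexed by one finite
    type, so that a product of [k] translates of the indicator expands over
    finite functions.  The proof is Lagrange interpolation: for [h != 1] and
    [chi h != 1], the combination [(chi x - chi h) / (1 - chi h)] is 1 at 1
    and 0 at [h]; these are multiplied over the listed elements [h]. *)
Lemma indicator1_char_comb (z : K) :
    abelian [set: gT] -> #|gT|.-primitive_root z ->
  exists N (d : 'I_N -> K) (chi : 'I_N -> dual_char gT K),
    forall x, \sum_j d j * chi j x = (x == 1%g)%:R.
Proof.
move=> abG prz.
have lagrange (s : seq gT) : exists f, [/\ char_comb f, f 1%g = 1 &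
    forall x, x \in s -> x != 1%g -> f x = 0].
  elim: s => [|h s [f [fC f1 f0]]].
    exists (fun=> 1); split=> //; exists [:: (1, dual_char1)] => x.
    by rewrite big_seq1 mulr1.
  have [->|hn1] := eqVneq h 1%g.
    by exists f; split=> // x /predU1P[->|/f0//]; rewrite eqxx.
  have [chi chih] := dual_char_separates abG prz hn1.
  pose c := (1 - chi h)^-1.
  have c1 : c * (1 - chi h) = 1 by rewrite mulVf // subr_eq0 eq_sym.
  exists (fun x => c * (chi x - chi h) * f x); split.
  - apply: char_combM fC; exists [:: (c, chi); (- (c * chi h), dual_char1)] => x.
    by rewrite big_cons big_seq1 /= mulr1 mulrBr.
  - by rewrite dual_char_at1 f1 mulr1.
  move=> x /predU1P[->|/f0 fx0 /fx0->]; last by rewrite mulr0.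
  by rewrite subrr mulr0 mul0r.
have [f [[r fE] f1 f0]] := lagrange (enum gT).
exists (size r), (fun j => (tnth (in_tuple r) j).1),
  (fun j => (tnth (in_tuple r) j).2) => x.
rewrite -(big_tnth _ _ r predT (fun p => p.1 * p.2 x)) -fE.
by have [->|/f0->//] := eqVneq x 1%g; rewrite ?mem_enum.
Qed.

End DualChar.

(** * Weighted permanents of character matrices *)

(** Treats the determinant (sign weights) and the permanent (unit weights)
    uniformly. *)
Definition immanant (R : comPzRingType) k (w : 'S_k -> R) (M : 'M[R]_k) : R :=
  \sum_(s : 'S_k) w s * \prod_(i < k) M i (s i).

Lemma immanant_sign (R : comPzRingType) k (M : 'M[R]_k) :
  immanant (fun s : 'S_k => (-1) ^+ s) M = \det M.
Proof. by []. Qed.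

Lemma immanant1 (R : comPzRingType) k (M : 'M[R]_k) :
  immanant (fun=> 1) M = permanent M.
Proof. by apply: eq_bigr => s _; rewrite mul1r. Qed.

Lemma immanant_char_mxM (gT : finGroupType) (K : fieldType) k
    (a b : 'I_k -> gT) (w1 w2 : 'S_k -> K) (chi : 'I_k -> dual_char gT K) :
  immanant w1 (char_mx chi a) * immanant w2 (char_mx chi b) =
  \sum_(s : 'S_k) \sum_(t : 'S_k)
     w1 s * w2 t * \prod_i chi i (a (s i) * b (t i))%g.
Proof.
rewrite /immanant big_distrlr; apply: eq_bigr => s _; apply: eq_bigr => t _.
rewrite /= mulrACA -big_split; congr (_ * _); apply: eq_bigr => i _.
by rewrite !mxE dual_charM.
Qed.

(** Multiplying the expansion of the previous lemma by the coefficients of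
    the translated indicators [x |-> (x == c i)] and summing over all tuples
    of characters extracts the coefficient of [c], which the hypothesis on
    [pi] identifies as [w1 1 * w2 pi]. *)
Lemma immanant_char_mx_neq0 (gT : finGroupType) (K : fieldType) (z : K) k
    (a b : 'I_k -> gT) (w1 w2 : 'S_k -> K) (pi : 'S_k) :
    abelian [set: gT] -> #|gT|.-primitive_root z ->
    (forall s t : 'S_k,
       (forall i, a (s i) * b (t i) = a i * b (pi i))%g -> s = 1%g /\ t = pi) ->
    w1 1%g != 0 -> w2 pi != 0 ->
  exists chi : 'I_k -> dual_char gT K,
    immanant w1 (char_mx chi a) != 0 /\ immanant w2 (char_mx chi b) != 0.
Proof.
move=> abG prz uniq_pi w1n0 w2n0.
have [N [d [chi dE]]] := indicator1_char_comb abG prz.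
pose c i := (a i * b (pi i))%g.
pose coef (f : {ffun 'I_k -> 'I_N}) :=
  \prod_i (d (f i) * chi (f i) (c i)^-1%g).
pose F (f : {ffun 'I_k -> 'I_N}) :=
  immanant w1 (char_mx (chi \o f) a) * immanant w2 (char_mx (chi \o f) b).
have prodE (x : 'I_k -> gT) :
    \sum_f coef f * \prod_i chi (f i) (x i) = \prod_i (x i == c i)%:R.
  transitivity (\prod_i \sum_j (d j * chi j (c i)^-1%g * chi j (x i))).
    rewrite bigA_distr_bigA; apply: eq_bigr => f _.
    by rewrite -big_split.
  apply: eq_bigr => i _; rewrite eq_sym eq_mulVg1 -dE.
  by apply: eq_bigr => j _; rewrite dual_charM mulrA.
have sumE : \sum_f coef f * F f = w1 1%g * w2 pi.
  transitivity (\sum_(s : 'S_k) \sum_(t : 'S_k)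
      w1 s * w2 t * \prod_i ((a (s i) * b (t i))%g == c i)%:R).
    under eq_bigr => f _ do rewrite /F immanant_char_mxM big_distrr /=.
    rewrite exchange_big; apply: eq_bigr => s _ /=.
    under eq_bigr => f _ do rewrite big_distrr /=.
    rewrite exchange_big; apply: eq_bigr => t _ /=.
    by rewrite -prodE big_distrr; apply: eq_bigr => f _; rewrite mulrCA.
  have zero (s t : 'S_k) : (s, t) != (1%g, pi) ->
      \prod_i ((a (s i) * b (t i))%g == c i)%:R = 0 :> K.
    move=> st; have [i ne] : exists i, (a (s i) * b (t i))%g != c i.
      apply/existsP; apply: contraR st => /existsPn eqc.
      have [|-> ->] := uniq_pi s t => // i.
      by apply/eqP; have := eqc i; rewrite negbK.
    by rewrite (bigD1 i) //= (negPf ne) mul0r.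
  rewrite (bigD1 1%g) //= (bigD1 pi) //= [X in _ + _ + X]big1 => [|s sn].
    rewrite [X in _ + X + _]big1 => [|t tn].
      by rewrite !addr0 big1 ?mulr1 // => i _; rewrite perm1 eqxx.
    by rewrite zero ?mulr0 // xpair_eqE eqxx.
  by rewrite big1 // => t _; rewrite zero ?mulr0 // xpair_eqE (negPf sn).
have [f Ff] : exists f, F f != 0.
  apply/existsP; move: (mulf_neq0 w1n0 w2n0); rewrite -sumE.
  apply: contraR => /existsPn F0; rewrite big1 // => f _.
  by have := F0 f; rewrite negbK => /eqP->; rewrite mulr0.
by exists (chi \o f); apply/andP; rewrite -negb_or -mulf_eq0.
Qed.

(** Reindexing the products [a (s i) * b (t i)] by [s] shows that
    [s^-1 * t] yields the same product set as [pi]; uniqueness then forces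
    [t = s * pi], so that the equations say that the injective map
    [i |-> a i * b (pi i)] is invariant under [s]. *)
Lemma unique_prod_set_pair (gT : finGroupType) k (a b : 'I_k -> gT)
    (pi : 'S_k) :
    #|prod_set a b pi| = k ->
    (forall tau : 'S_k, tau != pi -> prod_set a b tau <> prod_set a b pi) ->
  forall s t : 'S_k,
    (forall i, a (s i) * b (t i) = a i * b (pi i))%g -> s = 1%g /\ t = pi.
Proof.
move=> cardC uniqC s t eqst.
have injc : injective (fun i => a i * b (pi i))%g.
  suff /imset_injP inj : #|prod_set a b pi| == #|'I_k| by move=> i j; apply: inj.
  by rewrite cardC card_ord.
have tE : t = (s * pi)%g.
  apply: (canRL (mulVKg s)); have [//|/uniqC[]] := eqVneq (s^-1 * t)%g pi.
  apply/setP=> x; apply/imsetP/imsetP=> [] [i _ ->].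
    by exists ((s^-1)%g i) => //; rewrite -eqst permKV permM.
  by exists (s i) => //; rewrite -eqst permM permK.
suff s1 : s = 1%g by rewrite tE s1 mul1g.
apply/permP=> i; rewrite perm1; apply: injc.
by rewrite -(eqst i) tE permM.
Qed.

(** * A determinant times a permanent *)

(** In the product of the two expansions, the pair of permutations [(s, t)]
    is the term of index [s] in the determinant with [u = s^-1 * t]. *)
Lemma det_mul_permanent (R : comPzRingType) k (A B : 'M[R]_k) :
  \det A * permanent B =
  \sum_(u : 'S_k) \det (\matrix_(i, j) (A i j * B i (u j))).
Proof.
rewrite /determinant /permanent big_distrlr [RHS]exchange_big; apply: eq_bigr => s _ /=.
rewrite (reindex_inj (mulgI s)); apply: eq_bigr => u _.
rewrite -mulrA -big_split; congr (_ * _); apply: eq_bigr => i _.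
by rewrite mxE permM.
Qed.

Lemma det_pchar2 (R : comNzRingType) k (M : 'M[R]_k) :
  2%N \in [pchar R] -> \det M = permanent M.
Proof.
move=> ch2; apply: eq_bigr => s _.
by rewrite oppr_pchar2 // expr1n mul1r.
Qed.

(** * Roots of unity in characteristic 2 *)

Lemma finField_prim_root (F : finFieldType) :
  exists z : F, #|F|.-1.-primitive_root z.
Proof.
have F1 : (0 < #|F|.-1)%N by rewrite -subn1 subn_gt0 finNzRing_gt1.
suff /hasP[z _ prz]: has #|F|.-1.-primitive_root (enum (predC1 (0 : F))).
  by exists z.
apply: has_prim_root => //; last 2 first.
- exact: enum_uniq.
- by rewrite -cardE cardC1.
apply/allP=> x; rewrite mem_enum inE => xn0; apply/unity_rootP.
apply: (mulfI xn0); rewrite -exprS prednK ?expf_card ?mulr1 //.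
exact: ltnW (finNzRing_gt1 F).
Qed.

(** By Euler's theorem [n] divides [2 ^ totient n - 1], the order of the
    cyclic multiplicative group of the field with [2 ^ totient n] elements. *)
Lemma pchar2_prim_root_exists n : odd n ->
  exists2 F : finFieldType, 2%N \in [pchar F] & exists z : F, n.-primitive_root z.
Proof.
move=> oddn; have n0 := odd_gt0 oddn.
have [F ch2 cardF] :=
  pPrimePowerField (isT : prime 2) (etrans (totient_gt0 n) n0).
exists F => //; have [z prz] := finField_prim_root F.
exists (z ^+ (#|F|.-1 %/ n)); apply: (dvdn_prim_root prz).
rewrite cardF -subn1 -eqn_mod_dvd ?expn_gt0 //.
by apply/eqP; apply: Euler_exp_totient; rewrite coprime2n.
Qed.

Theorem theorem1p11 :
  (statement_D -> statement_S) /\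
  (forall (gT : finGroupType) (k : nat) (a b : 'I_k -> gT) (K : fieldType),
     abelian [set: gT] -> injective a -> injective b ->
     (exists z : K, #|gT|.-primitive_root z) ->
     (exists pi : 'S_k,
        #|prod_set a b pi| = k /\
        (forall tau : 'S_k, tau != pi ->
           prod_set a b tau <> prod_set a b pi)) ->
     [/\ exists chi : 'I_k -> dual_char gT K,
           \det (char_mx chi a) != 0 /\ \det (char_mx chi b) != 0,
         exists chi : 'I_k -> dual_char gT K,
           \det (char_mx chi a) != 0 /\ permanent (char_mx chi b) != 0
       & exists psi : 'I_k -> dual_char gT K,
           permanent (char_mx psi a) != 0 /\
           permanent (char_mx psi b) != 0]).
Proof.
split=> [stD gT abG oddG k k_gt0 a b inja injb
        |gT k a b K abG inja injb [z prz] [pi [cardC uniqC]]].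
  have [F ch2 prF] := pchar2_prim_root_exists oddG.
  have [chi [deta detb]] := stD _ abG _ k_gt0 _ _ inja injb F prF.
  have := mulf_neq0 deta detb.
  rewrite [X in _ * X]det_pchar2 // det_mul_permanent.
  move=> sumD.
  have [u Du] : exists u : 'S_k,
      \det (\matrix_(i, j) (char_mx chi a i j * char_mx chi b i (u j))) != 0.
    apply/existsP; apply: contraR sumD => /existsPn D0.
    by rewrite big1 // => u _; have := D0 u; rewrite negbK => /eqP.
  (* A collision between [i] and [j] would make these two columns equal. *)
  exists u => i j /= eqij; apply: contraNeq Du => ij.
  rewrite -det_tr (determinant_alternate ij) // => l.
  by rewrite !mxE -!dual_charM eqij.
have sol := unique_prod_set_pair cardC uniqC.
have imm w1 w2 := immanant_char_mx_neq0 (w1 := w1) (w2 := w2) abG prz sol.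
pose sgn (s : 'S_k) : K := (-1) ^+ s.
pose one (s : 'S_k) : K := 1.
have sgn_neq0 s : sgn s != 0 by rewrite signr_eq0.
have one_neq0 s : one s != 0 := oner_neq0 K.
split.
- exact: (imm sgn sgn).
- have [//|//|chi [deta perb]] := imm sgn one.
  by exists chi; rewrite -immanant1.
- have [//|//|chi [pera perb]] := imm one one.
  by exists chi; rewrite -!immanant1.
Qed.
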